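(* (Weak supercommutativity) Let $(V,Y(\cdot,(x,\varphi)),\mathbf{1},\tau)$ be an ($N=1$ Neveu-Schwarz) vertex operator superalgebra over $\bigwedge_*$ with odd formal variables and let $u,v\in V$ be of homogeneous sign. Then there exists a positive integer $k$ such that $$(x_1-x_2-\varphi_1\varphi_2)^kY(u,(x_1,\varphi_1))Y(v,(x_2,\varphi_2))=(-1)^{\eta(u)\eta(v)}(x_1-x_2-\varphi_1\varphi_2)^kY(v,(x_2,\varphi_2))Y(u,(x_1,\varphi_1)).$$ Furthermore, this weak supercommutativity follows from the truncation condition (axiom (1)) and the Jacobi identity (axiom (4)).
   Context: **Grassmann algebras and conventions.** $\bigwedge_*$ denotes either $\bigwedge_L$, the exterior algebra over $\mathbb{C}$ of an $L$-dimensional complex vector space $U_L$ ($L\in\mathbb{N}$, $U_L\subset U_{L+1}$), or the direct limit $\bigwedge_\infty$ of the $\bigwedge_L$; it is $\mathbb{Z}_2$-graded, $\bigwedge_*=\bigwedge_*^0\oplus\bigwedge_*^1$. For a $\mathbb{Z}_2$-graded space, $\eta(v)=i$ for $v$ homogeneous of sign $i\in\{0,1\}$. $[A,B]$ denotes the supercommutator $AB-(-1)^{\eta(A)\eta(B)}BA$ for homogeneous $A,B$. Even formal variables ($x,x_0,x_1,x_2$) commute with everything. Odd formal variables ($\varphi,\varphi_1,\varphi_2$) commute with even variables and with even elements of $\bigwedge_*$ and even operators, anticommute with each other and with odd elements of $\bigwedge_*$ and odd operators, and square to zero. $\delta(x)=\sum_{n\in\mathbb{Z}}x^n$. Expressions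 such as $(x_1-x_2)^n$, $n\in\mathbb{Z}$, are expanded in nonnegative powers of the second variable, and functions of even and odd variables are expanded about the even variables: $(x_1-x_2-\varphi_1\varphi_2)^n=(x_1-x_2)^n-n\varphi_1\varphi_2(x_1-x_2)^{n-1}$, so $\delta\left(\frac{x_1-x_2-\varphi_1\varphi_2}{x_0}\right)=\sum_{n\in\mathbb{Z}}(x_1-x_2-\varphi_1\varphi_2)^nx_0^{-n}$, and similarly for other such expressions. $Y$ is extended linearly to series with formal-variable coefficients. **Vertex operator superalgebra over $\bigwedge_*$ with odd formal variables.** This is a $\frac12\mathbb{Z}$-graded (by weight) $\bigwedge_*$-module, also $\mathbb{Z}_2$-graded (by sign), $V=\coprod_{n\in\frac12\mathbb{Z}}V_{(n)}=\coprod_{n}V^0_{(n)}\oplus\coprod_nV^1_{(n)}=V^0\oplus V^1$, with $\dim V_{(n)}<\infty$ for all $n\in\frac12\mathbb{Z}$ and $V_{(n)}=0$ for $n$ sufficiently small (positive energy), equipped with a linear map $V\otimes V\to V[[x,x^{-1}]][\varphi]$, equivalently $V\to(\mathrm{End}\,V)[[x,x^{-1}]][\varphi]$, $v\mapsto Y(v,(x,\varphi))=\sum_{n\in\mathbb{Z}}v_nx^{-n-1}+\varphi\sum_{n\in\mathbb{Z}}v_{n-\frac12}x^{-n-1}$, where $v_n\in(\mathrm{End}\,V)^{\eta(v)}$ and $v_{n-\frac12}\in(\mathrm{End}\,V)^{(\eta(v)+1)\bmod 2}$ for $v$ of homogeneous sign, and with distinguished vectors $\mathbf{1}\in V^0_{(0)}$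 (vacuum) and $\tau\in V^1_{(3/2)}$ (Neveu-Schwarz element), such that for $u,v\in V$: (1) (truncation) $u_nv=0$ for $n\in\frac12\mathbb{Z}$ sufficiently large; (2) $Y(\mathbf{1},(x,\varphi))=1$; (3) (creation) $Y(v,(x,\varphi))\mathbf{1}\in V[[x]][\varphi]$ and $\lim_{(x,\varphi)\to0}Y(v,(x,\varphi))\mathbf{1}=v$; (4) (Jacobi identity) for $u,v$ of homogeneous sign, $$x_0^{-1}\delta\left(\tfrac{x_1-x_2-\varphi_1\varphi_2}{x_0}\right)Y(u,(x_1,\varphi_1))Y(v,(x_2,\varphi_2))-(-1)^{\eta(u)\eta(v)}x_0^{-1}\delta\left(\tfrac{x_2-x_1+\varphi_1\varphi_2}{-x_0}\right)Y(v,(x_2,\varphi_2))Y(u,(x_1,\varphi_1))$$ $$=x_2^{-1}\delta\left(\tfrac{x_1-x_0-\varphi_1\varphi_2}{x_2}\right)Y(Y(u,(x_0,\varphi_1-\varphi_2))v,(x_2,\varphi_2));$$ (5) (Neveu-Schwarz relations) with $G(n+\frac12)=\tau_{n+1}$ and $2L(n)=\tau_{n+\frac12}$ for $n\in\mathbb{Z}$, one has for $m,n\in\mathbb{Z}$: $[L(m),L(n)]=(m-n)L(m+n)+\frac1{12}(m^3-m)\delta_{m+n,0}(\mathrm{rank}\,V)$, $[G(m+\frac12),L(n)]=(m-\frac{n-1}{2})G(m+n+\frac12)$, $[G(m+\frac12),G(n-\frac12)]=2L(m+n)+\frac13(m^2+m)\delta_{m+n,0}(\mathrm{rank}\,V)$,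 where $\mathrm{rank}\,V\in\mathbb{C}$; (6) $L(0)v=nv$ for $n\in\frac12\mathbb{Z}$ and $v\in V_{(n)}$; (7) ($G(-\frac12)$-derivative property) $\left(\frac{\partial}{\partial\varphi}+\varphi\frac{\partial}{\partial x}\right)Y(v,(x,\varphi))=Y(G(-\tfrac12)v,(x,\varphi))$. *)

(* Defs.v *)
From HB Require Import structures.
From mathcomp Require Import all_boot all_order all_algebra.
From mathcomp Require Import finmap.
From mathcomp Require Import boolp classical_sets fsbigop reals.
From mathcomp Require Import complex.
From mathcomp Require Import monalg.

Set Implicit Arguments.
Unset Strict Implicit.
Unset Printing Implicit Defensive.

Import Order.TTheory GRing.Theory Num.Theory.
Local Open Scope fset_scope.
Local Open Scope ring_scope.

(* The exterior algebra on generators zeta_i, with i < l for L = Some l (this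
   is bigwedge_l) and i : nat for L = None (this is bigwedge_infty: the direct
   limit of the bigwedge_l is the exterior algebra on the union of the U_l).
   It has the basis zeta_A = zeta_{i_1} ... zeta_{i_k}, for A = {i_1 < ... <
   i_k} a finite set of indices.  *)

Definition gbound (L : option nat) : pred nat :=
  fun i => if L is Some l then (i < l)%N else true.
Definition gidx (L : option nat) : choiceType := {i : nat | gbound L i}.

Section Grassmann.
Variables (F : fieldType) (L : option nat).
Implicit Types A B D : {fset gidx L}.

Definition grassmann : Type := {malg F[{fset gidx L}]}.
HB.instance Definition _ := GRing.Lmodule.on grassmann.
Implicit Types g h : grassmann.

Definition ginv A B : nat :=
  (\sum_(i <- A) \sum_(j <- B) (val j < val i)%N)%N.

(* zeta_A zeta_B = gsign A B zeta_(A `|` B) *)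
Definition gsign A B : F :=
  if [disjoint A & B]%fset then (-1) ^+ ginv A B else 0.

Definition gmul g h : grassmann :=
  \sum_(A <- msupp g) \sum_(B <- msupp h)
    << gsign A B * (g@_A * h@_B) *g (A `|` B) >>.

Definition gone : grassmann := << 1 *g fset0 >>.

Definition gparity (i : bool) (g : grassmann) : Prop :=
  forall A, A \in msupp g -> odd #|` A| = i.

Fact sum_fsetU (f : gidx L -> nat) A B : [disjoint A & B]%fset ->
  (\sum_(i <- A `|` B) f i = \sum_(i <- A) f i + \sum_(i <- B) f i)%N.
Proof.
move=> dAB; rewrite -big_cat; apply/perm_big/uniq_perm.
- exact: fset_uniq.
- rewrite cat_uniq !fset_uniq andbT /=; apply/hasPn => x xB.
  by apply/negP => xA; have /fdisjointP/(_ x xA) := dAB; rewrite xB.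
by move=> x; rewrite mem_cat in_fsetU.
Qed.

Fact ginvUl A B D : [disjoint A & B]%fset ->
  ginv (A `|` B) D = (ginv A D + ginv B D)%N.
Proof. exact: sum_fsetU. Qed.

Fact ginvUr A B D : [disjoint B & D]%fset ->
  ginv A (B `|` D) = (ginv A B + ginv A D)%N.
Proof.
move=> dBD; rewrite /ginv -big_split /=.
by apply: eq_bigr => i _; rewrite sum_fsetU.
Qed.

Fact gsignA A B D :
  gsign A B * gsign (A `|` B) D = gsign B D * gsign A (B `|` D).
Proof.
rewrite /gsign fdisjointUX fdisjointXU.
case dAB: [disjoint A & B]%fset; case dBD: [disjoint B & D]%fset;
  case dAD: [disjoint A & D]%fset; rewrite ?(mul0r, mulr0) //=.
by rewrite ginvUl // ginvUr // -!exprD addnA addnC.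
Qed.

Fact gsign0A A : gsign fset0 A = 1.
Proof. by rewrite /gsign fdisjoint0X /ginv big_seq_fset0. Qed.

Fact gsignA0 A : gsign A fset0 = 1.
Proof.
by rewrite /gsign fdisjointX0 /ginv big1 // => i _; rewrite big_seq_fset0.
Qed.

Fact gmulw (d1 d2 : {fset {fset gidx L}}) g h :
  msupp g `<=` d1 -> msupp h `<=` d2 ->
  gmul g h = \sum_(A <- d1) \sum_(B <- d2)
    << gsign A B * (g@_A * h@_B) *g (A `|` B) >>.
Proof.
move=> le1 le2; rewrite /gmul (big_fset_incl _ le1) /=.
  apply: eq_bigr => A _; apply: big_fset_incl => // B _ /mcoeff_outdom ->.
  by rewrite !mulr0 monalgU0.
move=> A _ /mcoeff_outdom gA; rewrite big1 // => B _.
by rewrite gA mul0r mulr0 monalgU0.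
Qed.

Fact gmulDl : left_distributive gmul +%R.
Proof.
move=> g1 g2 h; pose d := msupp g1 `|` msupp g2.
rewrite (@gmulw d (msupp h)) ?fsubset_refl ?msuppD_le //.
rewrite (@gmulw d (msupp h) g1) ?fsubset_refl ?fsubsetUl //.
rewrite (@gmulw d (msupp h) g2) ?fsubset_refl ?fsubsetUr //.
rewrite -big_split /=; apply: eq_bigr => A _.
rewrite -big_split /=; apply: eq_bigr => B _.
by rewrite -monalgUD mcoeffD mulrDl mulrDr.
Qed.

Fact gmulDr : right_distributive gmul +%R.
Proof.
move=> h g1 g2; pose d := msupp g1 `|` msupp g2.
rewrite (@gmulw (msupp h) d) ?fsubset_refl ?msuppD_le //.
rewrite (@gmulw (msupp h) d _ g1) ?fsubset_refl ?fsubsetUl //.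
rewrite (@gmulw (msupp h) d _ g2) ?fsubset_refl ?fsubsetUr //.
rewrite -big_split /=; apply: eq_bigr => A _.
rewrite -big_split /=; apply: eq_bigr => B _.
by rewrite -monalgUD mcoeffD !mulrDr.
Qed.

Fact gmul0g h : gmul 0 h = 0.
Proof. by rewrite /gmul msupp0 big_seq_fset0. Qed.

Fact gmulg0 h : gmul h 0 = 0.
Proof. by rewrite /gmul big1 // => A _; rewrite msupp0 big_seq_fset0. Qed.

Fact gmul_suml (I : Type) (s : seq I) (f : I -> grassmann) h :
  gmul (\sum_(i <- s) f i) h = \sum_(i <- s) gmul (f i) h.
Proof.
exact: (big_morph (gmul^~ h) (fun x y => gmulDl x y h) (gmul0g h)).
Qed.

Fact gmul_sumr (I : Type) (s : seq I) (f : I -> grassmann) h :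
  gmul h (\sum_(i <- s) f i) = \sum_(i <- s) gmul h (f i).
Proof.
exact: (big_morph (gmul h) (gmulDr h) (gmulg0 h)).
Qed.

Fact gmulUU (x y : F) A B :
  gmul << x *g A >> << y *g B >> = << gsign A B * (x * y) *g (A `|` B) >>.
Proof.
by rewrite (gmulw msuppU_le msuppU_le) !big_seq_fset1 !mcoeffUU.
Qed.

Fact gmulA : associative gmul.
Proof.
move=> g h k; rewrite (monalgE g) (monalgE h) (monalgE k).
rewrite [LHS]gmul_suml [X in _ = gmul X _]gmul_suml [RHS]gmul_suml.
apply: eq_bigr => A _; rewrite [X in gmul _ X = _]gmul_suml [LHS]gmul_sumr.
rewrite [X in _ = gmul X _]gmul_sumr [RHS]gmul_suml.
apply: eq_bigr => B _; rewrite [X in gmul _ X = _]gmul_sumr.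
rewrite [LHS]gmul_sumr [RHS]gmul_sumr.
apply: eq_bigr => D _; rewrite !gmulUU fsetUA; congr (<< _ *g _ >>).
move: (gsignA A B D).
move: (gsign A B) (gsign (A `|` B) D) (gsign B D) (gsign A (B `|` D)).
move=> a b c d e.
by rewrite [g@_A * (c * _)]mulrCA [LHS]mulrA [d * c]mulrC -e !mulrA [b * a]mulrC.
Qed.

Fact gmul1g : left_id gone gmul.
Proof.
move=> g; rewrite {1 2}(monalgE g) gmul_sumr; apply: eq_bigr => A _.
by rewrite gmulUU gsign0A fset0U !mul1r.
Qed.

Fact gmulg1 : right_id gone gmul.
Proof.
move=> g; rewrite {1 2}(monalgE g) gmul_suml; apply: eq_bigr => A _.
by rewrite gmulUU gsignA0 fsetU0 mulr1 !mul1r.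
Qed.

Fact gone_neq0 : gone != 0.
Proof. by rewrite monalgU_eq0 oner_neq0. Qed.

HB.instance Definition _ := GRing.Zmodule_isNzRing.Build grassmann
  gmulA gmul1g gmulg1 gmulDl gmulDr gone_neq0.

Fact gscaleU (c x : F) A : c *: (<< x *g A >> : grassmann) = << c * x *g A >>.
Proof.
by apply/malgP => B; rewrite mcoeffZ !mcoeffU mulrnAr.
Qed.

Fact gscaleAl (c : F) g h : c *: (g * h) = (c *: g) * h.
Proof.
rewrite [RHS](@gmulw (msupp g) (msupp h)) ?msuppZ_le ?fsubset_refl //.
rewrite [LHS]scaler_sumr; apply: eq_bigr => A _.
rewrite [LHS]scaler_sumr; apply: eq_bigr => B _.
by rewrite gscaleU mcoeffZ -mulrA mulrCA.
Qed.

Fact gscaleAr (c : F) g h : c *: (g * h) = g * (c *: h).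
Proof.
rewrite [RHS](@gmulw (msupp g) (msupp h)) ?msuppZ_le ?fsubset_refl //.
rewrite [LHS]scaler_sumr; apply: eq_bigr => A _.
rewrite [LHS]scaler_sumr; apply: eq_bigr => B _.
by rewrite gscaleU mcoeffZ mulrCA [c * (_ * _)]mulrCA.
Qed.

HB.instance Definition _ :=
  GRing.Lmodule_isLalgebra.Build F grassmann gscaleAl.
HB.instance Definition _ :=
  GRing.Lalgebra_isAlgebra.Build F grassmann gscaleAr.

End Grassmann.

(* Formal series in the even variables x_0, x_1, x_2 and the odd variables
   phi_1, phi_2 (index 0 and 1 of 'I_2): the value at (a, S) is the coefficient
   of x^a phi^S, where phi^S, with its factors in increasing order, is written
   to the left of the coefficient.  *)
Notation evexp := {ffun 'I_3 -> int}.
Notation odexp := {set 'I_2}.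

Definition x0 : 'I_3 := @Ordinal 3 0 isT.
Definition x1 : 'I_3 := @Ordinal 3 1 isT.
Definition x2 : 'I_3 := @Ordinal 3 2 isT.
Definition phi1 : 'I_2 := @Ordinal 2 0 isT.
Definition phi2 : 'I_2 := @Ordinal 2 1 isT.

Definition series (T : Type) := evexp -> odexp -> T.

(* phi^S phi^T = (-1)^(osign S T) phi^(S :|: T) for S and T disjoint *)
Definition osign (S T : odexp) : nat :=
  (\sum_(i in S) \sum_(j in T) (j < i)%N)%N.

Definition only_in (i : 'I_3) (a : evexp) : bool :=
  [forall j, (j != i) ==> (a j == 0)].

Section ScalarSeries.
Variable F : fieldType.

Definition gbinom (n : int) (i : nat) : F :=
  (\prod_(j < i) (n%:~R - j%:R)) / (i`!)%:R.

(* (x_i - x_j)^n, expanded in nonnegative powers of x_j *)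
Definition xpow (i j : 'I_3) (n : int) (a : evexp) : F :=
  if [&& [forall k, (k != i) && (k != j) ==> (a k == 0)],
         0 <= a j & a i + a j == n]
  then (-1) ^+ `|a j|%N * gbinom n `|a j|%N else 0.

(* (x_i - x_j + e phi_1 phi_2)^n
   = (x_i - x_j)^n + e n phi_1 phi_2 (x_i - x_j)^(n - 1) *)
Definition superpow (i j : 'I_3) (e : F) (n : int) : series F := fun a S =>
  if S == finset.set0 then xpow i j n a
  else if S == finset.setT then e * n%:~R * xpow i j (n - 1) a
  else 0.

(* x_l^-1 delta((x_i - x_j + e phi_1 phi_2) / (s x_l))
   = \sum_(n in Z) s^-n (x_i - x_j + e phi_1 phi_2)^n x_l^(-n - 1);
   it is used with l distinct from i and j *)
Definition superdelta (l i j : 'I_3) (e s : F) : series F := fun a S =>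
  let n := - a l - 1 in
  s ^ (- n) * superpow i j e n [ffun k => if k == l then 0 else a k] S.

End ScalarSeries.

Section VertexSuperalgebra.
Variables (R : realType) (L : option nat).
Local Notation C := R[i].
Local Notation Lambda := (grassmann C L).
Variable V : lmodType Lambda.

Definition subgroup (W : set V) : Prop :=
  W 0 /\ forall v w, W v -> W w -> W (v - w).

Definition direct_sum (I : eqType) (W : I -> set V) : Prop :=
  (forall v, exists (s : seq I) (c : I -> V),
    [/\ uniq s, forall i, W i (c i) & v = \sum_(i <- s) c i]) /\
  (forall (s : seq I) (c : I -> V), uniq s -> (forall i, W i (c i)) ->
    \sum_(i <- s) c i = 0 -> forall i, i \in s -> c i = 0).

(* sgn i is V^i *)
Record supermodule (sgn : bool -> set V) : Prop := {
  sgn_subgroup : forall i, subgroup (sgn i);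
  sgn_scale : forall i j (a : Lambda) v,
    gparity i a -> sgn j v -> sgn (i (+) j) (a *: v);
  sgn_direct : direct_sum sgn }.

(* Half-integers are represented by their doubles: wt n is V_(n/2).
   dim V_(n) < infinity means finite generation over bigwedge_*: over C,
   the algebra bigwedge_infty itself is infinite-dimensional.  *)
Record weight_grading (sgn : bool -> set V) (wt : int -> set V) : Prop := {
  wt_subgroup : forall n, subgroup (wt n);
  wt_scale : forall n (a : Lambda) v, wt n v -> wt n (a *: v);
  wt_direct : direct_sum wt;
  wt_sgn : forall n v, wt n v -> exists v0 v1,
    [/\ wt n v0 /\ sgn false v0, wt n v1 /\ sgn true v1 & v = v0 + v1];
  wt_fingen : forall n, exists s : seq V,
    (forall w, w \in s -> wt n w) /\
    (forall v, wt n v -> exists c : V -> Lambda, v = \sum_(w <- s) c w *: w);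
  wt_positive : exists N, forall n v, n < N -> wt n v -> v = 0 }.

(* (End V)^p: the odd scalars anticommute with the odd endomorphisms *)
Record super_endo (sgn : bool -> set V) (p : bool) (T : V -> V) : Prop := {
  endo_add : forall v w, T (v + w) = T v + T w;
  endo_scale : forall i (a : Lambda) v,
    gparity i a -> T (a *: v) = (-1) ^+ (p && i) *: (a *: T v);
  endo_sgn : forall j v, sgn j v -> sgn (p (+) j) (T v) }.

Section VertexOperators.
(* mode v n is the operator v_(n/2); thus v_n is mode v (2 n) and v_(n - 1/2)
   is mode v (2 n - 1). *)
Variable mode : V -> int -> V -> V.

(* the coefficient of x^m phi^e in
   Y(u,(x,phi))w = \sum_n u_n w x^(-n-1) + phi \sum_n u_(n-1/2) w x^(-n-1) *)
Definition Ycoef (u w : V) (m : int) (e : bool) : V :=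
  mode u ((- m - 1) *+ 2 - e%:Z) w.

(* The sign in Y_scale comes from a * phi = - phi * a for a odd. *)
Record vertex_map (sgn : bool -> set V) : Prop := {
  Y_add : forall u v w m e, Ycoef (u + v) w m e = Ycoef u w m e + Ycoef v w m e;
  Y_scale : forall i (a : Lambda) u w m e, gparity i a ->
    Ycoef (a *: u) w m e = (-1) ^+ (i && e) *: (a *: Ycoef u w m e);
  Y_endo : forall p u m e, sgn p u ->
    super_endo sgn (p (+) e) (fun w => Ycoef u w m e) }.

(* A series with coefficients in End V is given by its values on vectors, so
   that only pointwise finite sums of operators are required.  *)
Definition opseries := V -> series V.

Definition scal (f : series C) : opseries := fun w a S => (f a S)%:A *: w.

(* The product of A and B when A has total parity p, i.e. when the coefficient
   A_T of phi^T has parity p + #|T|, so that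
   A_T phi^S = (-1)^((p + #|T|) #|S|) phi^S A_T. The sum over b is over the
   finite support of its terms.  *)
Definition opmul (p : bool) (A B : opseries) : opseries := fun w a S =>
  \sum_(b \in [set: evexp]) \sum_(T : odexp | T \subset S)
    (-1) ^+ (osign T (S :\: T) + (p + #|T|) * #|S :\: T|)
      *: A (B w (a - b) (S :\: T)) b T.

(* Y(u,(x_i,phi_k)) *)
Definition Yop (u : V) (i : 'I_3) (k : 'I_2) : opseries := fun w a S =>
  if only_in i a && (S \subset [set k]%SET) then Ycoef u w (a i) (k \in S)
  else 0.

(* Y(u,(x_i,phi_k - phi_l))v *)
Definition Ydiff (u v : V) (i : 'I_3) (k l : 'I_2) : series V := fun a S =>
  if ~~ only_in i a then 0
  else if S == finset.set0 then Ycoef u v (a i) false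
  else if S == [set k]%SET then Ycoef u v (a i) true
  else if S == [set l]%SET then - Ycoef u v (a i) true
  else 0.

(* Y(f,(x_i,phi_k)) for a V-valued series f, with
   Y(x^b phi^T v,(x_i,phi_k)) = x^b phi^T Y(v,(x_i,phi_k)) *)
Definition Yext (f : series V) (i : 'I_3) (k : 'I_2) : opseries := fun w a S =>
  \sum_(b \in [set: evexp]) \sum_(T : odexp | T \subset S)
    (-1) ^+ osign T (S :\: T) *: Yop (f b T) i k w (a - b) (S :\: T).

Definition truncation : Prop := forall u v, exists N : int,
  forall n, N <= n -> mode u n v = 0.

Definition jacobi (sgn : bool -> set V) : Prop :=
  forall p q u v, sgn p u -> sgn q v -> forall w a S,
    opmul false (scal (superdelta x0 x1 x2 (-1) 1))
      (opmul p (Yop u x1 phi1) (Yop v x2 phi2)) w a S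
    - (-1) ^+ (p && q) *:
      opmul false (scal (superdelta x0 x2 x1 1 (-1)))
        (opmul q (Yop v x2 phi2) (Yop u x1 phi1)) w a S
    = opmul false (scal (superdelta x2 x1 x0 (-1) 1))
        (Yext (Ydiff u v x0 phi1 phi2) x2 phi2) w a S.

Definition weak_supercommutativity (p q : bool) (u v : V) (k : nat) : Prop :=
  forall w a S,
    opmul false (scal (superpow x1 x2 (-1) k))
      (opmul p (Yop u x1 phi1) (Yop v x2 phi2)) w a S
    = (-1) ^+ (p && q) *:
      opmul false (scal (superpow x1 x2 (-1) k))
        (opmul q (Yop v x2 phi2) (Yop u x1 phi1)) w a S.

Definition supercomm (p q : bool) (A B : V -> V) : V -> V :=
  fun w => A (B w) - (-1) ^+ (p && q) *: B (A w).

(* the action of a complex number *)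
Local Notation "c ** v" := ((c : C)%:A *: v) (at level 40).

(* opL tau n is L(n); opG tau n is G(n + 1/2) *)
Definition opL (tau : V) (n : int) : V -> V :=
  fun w => 2^-1 ** mode tau (n *+ 2 + 1) w.
Definition opG (tau : V) (n : int) : V -> V := mode tau ((n + 1) *+ 2).

Record NS_relations (tau : V) (rk : C) : Prop := {
  NS_LL : forall (m n : int) w,
    supercomm false false (opL tau m) (opL tau n) w =
    (m - n)%:~R ** opL tau (m + n) w
    + (12^-1 * (m ^+ 3 - m)%:~R * (m + n == 0)%:R * rk) ** w;
  NS_GL : forall (m n : int) w,
    supercomm true false (opG tau m) (opL tau n) w =
    (m%:~R - (n - 1)%:~R / 2) ** opG tau (m + n) w;
  NS_GG : forall (m n : int) w,
    supercomm true true (opG tau m) (opG tau (n - 1)) w =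
    2 ** opL tau (m + n) w
    + (3^-1 * (m ^+ 2 + m)%:~R * (m + n == 0)%:R * rk) ** w }.

(* ((d/dphi) + phi (d/dx)) f for f in V[[x, x^-1]][phi], given by its
   coefficients f m e of x^m phi^e *)
Definition superderiv (f : int -> bool -> V) : int -> bool -> V :=
  fun m e => if e then f (m + 1) false *~ (m + 1) else f m true.

Record NS_vosa (sgn : bool -> set V) (wt : int -> set V) (vac tau : V)
    (rk : C) : Prop := {
  vosa_supermodule : supermodule sgn;
  vosa_weight : weight_grading sgn wt;
  vosa_vertex_map : vertex_map sgn;
  vosa_vac : wt 0 vac /\ sgn false vac;
  vosa_tau : wt 3 tau /\ sgn true tau;
  vosa_truncation : truncation;
  vosa_vacuum : forall w m e,
    Ycoef vac w m e = if (m == 0) && ~~ e then w else 0;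
  vosa_creation : forall v,
    (forall m e, m < 0 -> Ycoef v vac m e = 0) /\ Ycoef v vac 0 false = v;
  vosa_jacobi : jacobi sgn;
  vosa_NS : NS_relations tau rk;
  vosa_L0 : forall n v, wt n v -> opL tau 0 v = (n%:~R / 2) ** v;
  vosa_deriv : forall v w m e,
    superderiv (Ycoef v w) m e = Ycoef (opG tau (-1) v) w m e }.

End VertexOperators.
End VertexSuperalgebra.

(* Main.v *)
Require Import Defs.
From mathcomp Require Import all_boot all_order all_algebra.
From mathcomp Require Import zify ring.
From mathcomp Require Import classical_sets fsbigop reals.
From mathcomp Require Import complex.

(** Weak supercommutativity is one residue of the Jacobi identity: the
    coefficient of x_0^(-k-1) for a large integer k > 0.

    On the left of the Jacobi identity only the delta functions involve x_0.
    Their coefficients of x_0^(-k-1) are (x_1 - x_2 - phi_1 phi_2)^k and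
    (-1)^k (x_2 - x_1 + phi_1 phi_2)^k.  As k >= 0, both binomial expansions
    are finite, so it does not matter in which variable one expands, and the
    two coefficients agree ([superpowC]).  Thus the left side becomes the
    difference of the two sides of weak supercommutativity
    ([product_residue]).

    On the right the delta function (x_1 - x_0 - phi_1 phi_2 over x_2) has only
    nonnegative powers of x_0, so a term in x_0^(-k-1) needs a power x_0^m with
    m <= -k-1 in Y(u,(x_0,phi_1 - phi_2))v.  By truncation there is none once k
    is large, and the right side vanishes ([iterate_residue_eq0]).

    The infinite sums defining the products are compared term by term after a
    translation of the summation index, so no finiteness of supports has to be
    established. *)

Set Implicit Arguments.
Unset Strict Implicit.
Unset Printing Implicit Defensive.

Import Order.TTheory GRing.Theory Num.Theory.

Local Open Scope ring_scope.

(** The exponent vector of x_l^n. *)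
Definition monomial (l : 'I_3) (n : int) : evexp :=
  [ffun k => if k == l then n else 0].

Section Powers.
Variable F : fieldType.

Lemma xpow_eq0 (i j l : 'I_3) n (a : evexp) :
  l != i -> l != j -> a l != 0 -> xpow F i j n a = 0.
Proof.
move=> li lj al; rewrite /xpow ifN //; apply/negP => /and3P[/forallP /(_ l)].
by rewrite li lj /= (negPf al).
Qed.

Lemma xpow_lt0 (i j : 'I_3) n (a : evexp) : a j < 0 -> xpow F i j n a = 0.
Proof.
move=> aj; rewrite /xpow ifN //.
by rewrite negb_and negb_and -[~~ (0 <= _)]ltNge aj orbT.
Qed.

Lemma superpow_eq0 (i j l : 'I_3) e n (a : evexp) S :
  l != i -> l != j -> a l != 0 -> @superpow F i j e n a S = 0.
Proof.
by move=> li lj al; rewrite /superpow !(xpow_eq0 _ li lj al) mulr0 !if_same.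
Qed.

Lemma superpow_lt0 (i j : 'I_3) e n (a : evexp) S :
  a j < 0 -> @superpow F i j e n a S = 0.
Proof. by move=> aj; rewrite /superpow !xpow_lt0 // mulr0 !if_same. Qed.

Lemma superdelta_lt0 (l i j : 'I_3) e s (a : evexp) S :
  l != j -> a j < 0 -> @superdelta F l i j e s a S = 0.
Proof.
move=> lj aj; rewrite /superdelta superpow_lt0 ?mulr0 //.
by rewrite ffunE eq_sym (negPf lj).
Qed.

(** Extracting a single power of x_l from the delta function turns it into a
    power of x_i - x_j + e phi_1 phi_2; the shift by one in the exponent is the
    prefactor x_l^-1. *)
Lemma superdelta_residue (l i j : 'I_3) e s n (a : evexp) S : a l = 0 ->
  @superdelta F l i j e s (a + monomial l (- n - 1)) S =
  s ^ (- n) * superpow i j e n a S.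
Proof.
move=> al; rewrite /superdelta !ffunE eqxx al add0r.
have -> : - (- n - 1) - 1 = n by lia.
congr (_ * superpow _ _ _ _ _ _); apply/ffunP => k.
by rewrite !ffunE; case: eqP => [->|]; rewrite ?al ?addr0.
Qed.
End Powers.

Section NaturalPowers.
Variable F : numFieldType.

Lemma gbinom_nat (k i : nat) : gbinom F k i = 'C(k, i)%:R.
Proof.
have fi0 : (i`!)%:R != 0 :> F by rewrite pnatr_eq0 -lt0n fact_gt0.
apply/(mulIf fi0).
rewrite /gbinom divfK // -natrM bin_ffact ffact_prod natr_prod.
have [ik|ki] := leqP i k.
  apply: eq_bigr => j _; rewrite natrB //.
  by rewrite ltnW // (leq_trans _ ik).
(* Both products contain the factor k - k. *)
rewrite (bigD1 (Ordinal ki)) //= subrr mul0r.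
by rewrite (bigD1 (Ordinal ki)) //= subnn mul0r.
Qed.

(** For a natural exponent the expansion is the finite binomial formula,
    whichever variable it is expanded in; this fails for negative exponents,
    where the difference of the two expansions is a delta-function term. *)
Lemma xpowC (i j : 'I_3) (k : nat) (a : evexp) :
  xpow F j i k a = (-1) ^+ k * xpow F i j k a.
Proof.
rewrite /xpow [a j + _]addrC !gbinom_nat.
under eq_forallb => l do rewrite andbC.
case: [forall _, _]; rewrite ?mulr0 //=.
case: (eqVneq (a i + a j) k) => [aij|]; rewrite ?andbF ?mulr0 // !andbT.
case: (lerP 0 (a i)) => ai; case: (lerP 0 (a j)) => aj.
- have kE : k = (`|a i| + `|a j|)%N by lia.
  rewrite kE exprD mulrA -[_ * _ * (-1) ^+ `|a j|%N]mulrA.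
  rewrite -expr2 sqrr_sign mulr1.
  by rewrite -[X in _ * X%:R = _]bin_sub ?leq_addr // addKn.
(* If one exponent is negative then the other one exceeds k. *)
- by rewrite bin_small ?mulr0 //; lia.
- by rewrite bin_small ?mulr0 //; lia.
- by rewrite mulr0.
Qed.

(** The nilpotent part k phi_1 phi_2 (x_i - x_j)^(k - 1) again has a natural
    exponent, except for k = 0, when its factor k makes it vanish. *)
Lemma superpowC (i j : 'I_3) (e : F) (k : nat) (a : evexp) S :
  superpow j i (- e) k a S = (-1) ^+ k * superpow i j e k a S.
Proof.
rewrite /superpow; case: ifP => _; first exact: xpowC.
case: ifP => _; last by rewrite mulr0.
case: k => [|k]; first by rewrite !(mulr0, mul0r).
have -> : (k.+1%:Z - 1)%R = k by lia.
rewrite xpowC exprS; ring.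
Qed.
End NaturalPowers.

Section Products.
Variables (R : realType) (L : option nat) (V : lmodType (grassmann R[i] L)).
Implicit Types (A B : opseries V) (w : V) (a b s : evexp) (S T : odexp).

Lemma opmul_eq0 p A B w a S :
  (forall b T S', A (B w (a - b) S') b T = 0) -> opmul p A B w a S = 0.
Proof.
move=> AB0; apply: fsbig1 => b _.
by rewrite big1 // => T _; rewrite AB0 scaler0.
Qed.

(** Multiplying a scalar series by x^s shifts its products by s.  The shifted
    series need only agree where the other factor does not vanish: a delta
    function has all powers of x_0, a product of vertex operators in x_1 and
    x_2 selects one of them. *)
Lemma opmul_scal_shift (f g : series R[i]) s B w a S :
  (forall b T S', B w (a - b) S' = 0 \/ f (b + s) T = g b T) ->
  opmul false (scal f) B w (a + s) S = opmul false (scal g) B w a S.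
Proof.
move=> fg; rewrite /opmul.
have sK : bijective (fun b : evexp => b + s).
  by exists (fun b => b - s) => b; rewrite ?addrK ?subrK.
rewrite (reindex_fsbigT (fun b : evexp => b + s)) //.
apply: eq_fsbigr => b _; apply: eq_bigr => T _; congr (_ *: _).
rewrite /scal opprD addrACA subrr addr0.
case: (fg b T (S :\: T)%SET) => ->; last by [].
by rewrite [LHS]scaler0 [RHS]scaler0.
Qed.
End Products.

Section VertexMaps.
Variables (R : realType) (L : option nat) (V : lmodType (grassmann R[i] L)).
Variables (mode : V -> int -> V -> V) (sgn : bool -> set V).

Lemma Yop_eq0 u (i l : 'I_3) k w (a : evexp) S :
  l != i -> a l != 0 -> Yop mode u i k w a S = 0.
Proof.
move=> li al; rewrite /Yop /only_in ifN // negb_and; apply/orP; left.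
by apply/negP => /forallP /(_ l); rewrite li (negPf al).
Qed.

Lemma truncation_Ycoef u v : truncation mode ->
  exists2 k, (0 < k)%N &
    forall m e, m <= - k%:Z - 1 -> Ycoef mode u v m e = 0.
Proof.
move=> /(_ u v)[N uvN]; exists `|N|.+1 => // m e mk.
by apply: uvN; case: e; lia.
Qed.

Hypothesis Yvm : vertex_map mode sgn.

Lemma Ycoef0 w m e : Ycoef mode 0 w m e = 0.
Proof.
by apply: (addrI (Ycoef mode 0 w m e)); rewrite -(Y_add Yvm) !addr0.
Qed.

Lemma Ycoefr0 p u m e : sgn p u -> Ycoef mode u 0 m e = 0.
Proof.
move=> up; have /endo_add Yadd := Y_endo Yvm m e up.
by apply: (addrI (Ycoef mode u 0 m e)); rewrite -[LHS]Yadd !addr0.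
Qed.

Lemma opmul_Yop_eq0 p u v (i j l : 'I_3) k k' w (a : evexp) S :
  sgn p u -> l != i -> l != j -> a l != 0 ->
  opmul p (Yop mode u i k) (Yop mode v j k') w a S = 0.
Proof.
move=> up li lj al; apply: opmul_eq0 => b T S'.
have [bl|/(Yop_eq0 _ _ _ _ li) -> //] := eqVneq (b l) 0.
rewrite (Yop_eq0 _ _ _ _ lj); last by rewrite !ffunE bl subr0.
by rewrite /Yop (Ycoefr0 _ _ up) if_same.
Qed.

(** If g is the coefficient of x_0^m in f, then multiplication by g gives the
    coefficient of x_0^m in f times a product that does not involve x_0. *)
Lemma product_residue p u v (i j : 'I_3) k k' (f g : series R[i]) m w
    (a : evexp) S :
  sgn p u -> x0 != i -> x0 != j -> a x0 = 0 ->
  (forall (b : evexp) T, b x0 = 0 -> f (b + monomial x0 m) T = g b T) ->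
  opmul false (scal f)
    (opmul p (Yop mode u i k) (Yop mode v j k')) w (a + monomial x0 m) S =
  opmul false (scal g)
    (opmul p (Yop mode u i k) (Yop mode v j k')) w a S.
Proof.
move=> up x0i x0j ax0 fg; apply: opmul_scal_shift => b T S'.
have [bx0|bx0] := eqVneq (b x0) 0; first by right; apply: fg.
left; apply: (opmul_Yop_eq0 _ _ _ _ _ up x0i x0j).
by rewrite !ffunE ax0 sub0r oppr_eq0.
Qed.

Lemma superpow_product_eq0 p u v (i j : 'I_3) k k' (i' j' : 'I_3) e n w
    (a : evexp) S :
  sgn p u -> x0 != i -> x0 != j -> x0 != i' -> x0 != j' -> a x0 != 0 ->
  opmul false (scal (superpow i' j' e n))
    (opmul p (Yop mode u i k) (Yop mode v j k')) w a S = 0.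
Proof.
move=> up x0i x0j x0i' x0j' ax0; apply: opmul_eq0 => b T S'.
have [bx0|bx0] := eqVneq (b x0) 0.
  rewrite /scal (opmul_Yop_eq0 _ _ _ _ _ up x0i x0j) ?scaler0 //.
  by rewrite !ffunE bx0 subr0.
by rewrite /scal (superpow_eq0 _ _ _ x0i' x0j' bx0) !scale0r.
Qed.

(** The delta function contributes only nonnegative powers of x_0 and the outer
    vertex operator none, so the power of x_0 in the inner vertex operator is
    at most that of the whole product, and there Y(u,(x_0,phi_k - phi_l))v
    vanishes. *)
Lemma iterate_residue_eq0 u v (N : int) (i : 'I_3) k l k' e s w (a : evexp) S :
  x0 != i ->
  (forall m e, m <= N -> Ycoef mode u v m e = 0) -> a x0 <= N ->
  opmul false (scal (superdelta i x1 x0 e s))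
    (Yext mode (Ydiff mode u v x0 k l) i k') w a S = 0.
Proof.
move=> x0i uv0 ax0; apply: opmul_eq0 => b T S'; rewrite /scal.
have [bx0|bx0] := ltrP (b x0) 0.
  by rewrite superdelta_lt0 ?scale0r // eq_sym.
rewrite [X in _ *: X](_ : _ = 0) ?scaler0 //.
apply: fsbig1 => c _; rewrite big1 // => T' _.
have [cx0|cx0] := lerP (c x0) N.
  by rewrite /Ydiff !uv0 // oppr0 !if_same /Yop Ycoef0 if_same scaler0.
rewrite (Yop_eq0 _ _ _ _ x0i) ?scaler0 //.
rewrite !ffunE lt_eqF // subr_lt0 (le_lt_trans _ cx0) //.
by rewrite (le_trans _ ax0) // gerBl.
Qed.

Lemma weak_supercommutativity_of_jacobi p q u v :
  truncation mode -> jacobi mode sgn -> sgn p u -> sgn q v ->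
  exists k : nat, (0 < k)%N /\ weak_supercommutativity mode p q u v k.
Proof.
move=> /truncation_Ycoef trunc jac up vq; have [k k_gt0 uv0] := trunc u v.
exists k; split => // w a S.
(* Neither side of weak supercommutativity involves x_0. *)
have [ax0|ax0] := eqVneq (a x0) 0; last first.
  by rewrite !superpow_product_eq0 ?scaler0.
have := jac p q u v up vq w (a + monomial x0 (- k%:Z - 1)) S.
have ax0k : (a + monomial x0 (- k%:Z - 1)) x0 <= - k%:Z - 1.
  by rewrite !ffunE eqxx ax0 add0r.
rewrite [RHS](iterate_residue_eq0 _ _ _ _ _ _ _ _ uv0 ax0k); last by [].
move/eqP; rewrite subr_eq0 => /eqP.
have uvE : forall (b : evexp) T, b x0 = 0 ->
    superdelta x0 x1 x2 (-1) 1 (b + monomial x0 (- k%:Z - 1)) T =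
    superpow x1 x2 (-1) k b T :> R[i].
  by move=> b T bx0; rewrite superdelta_residue // exp1rz mul1r.
have vuE : forall (b : evexp) T, b x0 = 0 ->
    superdelta x0 x2 x1 1 (-1) (b + monomial x0 (- k%:Z - 1)) T =
    superpow x1 x2 (-1) k b T :> R[i].
  move=> b T bx0; rewrite superdelta_residue //.
  (* The sign (-1)^k of the expansion in the other variable cancels the sign
     (-1)^(-k) of the denominator - x_0. *)
  rewrite -[X in superpow _ _ X]opprK superpowC mulrA.
  by rewrite -exprnN invr_sign -expr2 sqrr_sign mul1r.
have x0x1 : x0 != x1 by [].
have x0x2 : x0 != x2 by [].
have uv_res := product_residue v phi1 phi2 w S up x0x1 x0x2 ax0 uvE.
have vu_res := product_residue u phi2 phi1 w S vq x0x2 x0x1 ax0 vuE.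
move=> jac_res; apply: etrans (esym uv_res) (etrans jac_res _).
exact: congr1 vu_res.
Qed.
End VertexMaps.

(* The second conjunct is the "Furthermore": only the structure of a Z_2-graded
   module, the parities and linearity of Y, truncation and the Jacobi identity
   are assumed. *)
Theorem proposition7p1 (R : realType) (L : option nat) :
  (forall (V : lmodType (grassmann R[i] L)) (mode : V -> int -> V -> V)
      (sgn : bool -> set V) (wt : int -> set V) (vac tau : V) (rk : R[i]),
    NS_vosa mode sgn wt vac tau rk ->
    forall (p q : bool) (u v : V), sgn p u -> sgn q v ->
    exists k : nat, (0 < k)%N /\ weak_supercommutativity mode p q u v k)
  /\
  (forall (V : lmodType (grassmann R[i] L)) (mode : V -> int -> V -> V)
      (sgn : bool -> set V),
    supermodule sgn -> vertex_map mode sgn ->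
    truncation mode -> jacobi mode sgn ->
    forall (p q : bool) (u v : V), sgn p u -> sgn q v ->
    exists k : nat, (0 < k)%N /\ weak_supercommutativity mode p q u v k).
Proof.
split=> V mode sgn.
  move=> wt vac tau rk vosa p q u v; apply: weak_supercommutativity_of_jacobi.
  - exact: vosa_vertex_map vosa.
  - exact: vosa_truncation vosa.
  - exact: vosa_jacobi vosa.
move=> _ Yvm trunc jac p q u v up vq.
exact: (weak_supercommutativity_of_jacobi Yvm trunc jac up vq).
Qed.
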